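(* Let $M$ be a compact connected surface without boundary equipped with a free action of the cyclic group $\mathbb{Z}_n$, and suppose that the triple $(M,\mathbb{Z}_n;\mathbb{R}^2)$ satisfies the Borsuk-Ulam property. Then $\mathrm{ind}_2(M,\mathbb{Z}_n)=2$ and $\mathrm{secat}(M\to M/\mathbb{Z}_n)=3$.
   Context: ''Map'' means continuous map. Here $n\geq 2$. For a finite group $G$ acting freely on the left on a Hausdorff space $X$, and a Hausdorff space $Y$, the triple $(X,G;Y)$ satisfies the Borsuk-Ulam property (that is, the $2$-nd Borsuk-Ulam property) if for every map $f:X\to Y$ there exist a point $x\in X$ and distinct $u_1,u_2\in G$ such that $f(u_1x)=f(u_2x)$. For $G$ of order $\ell$ with a fixed enumeration $G=\{g_1,\ldots,g_\ell\}$, let $h(g_j)=j$ and let $F(Y,\ell,2)\subset Y^\ell$ (subspace topology) be the set of $(y_1,\ldots,y_\ell)$ with pairwise distinct entries, with left $G$-action $g(y_1,\ldots,y_\ell)=(y_{h(g^{-1}g_1)},\ldots,y_{h(g^{-1}g_\ell)})$. The index $\mathrm{ind}_2(X,G)$ is the least integer $k\in\{0,1,2,\ldots\}$ such that there exists a $G$-equivariant map $X\to F(\mathbb{R}^{k+1},\ell,2)$, and $\infty$ if no such $k$ exists. For a fibration $\pi:E\to B$ (in particular the quotient map $M\to M/\mathbb{Z}_n$), the sectional category $\mathrm{secat}(\pi)$ is the minimal cardinality of an open cover of $B$ such that each element $U$ of the cover admits a local section of $\pi$ (a map $s:U\to E$ with $\pi\circ s$ equal to the inclusion $U\hookrightarrow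 B$); $\mathrm{secat}(\pi)=\infty$ if no such finite cover exists. *)

(* Defs.v *)
From HB Require Import structures.
From mathcomp Require Import all_boot all_order all_fingroup all_algebra.
From mathcomp Require Import all_classical all_reals topology.
From mathcomp Require Import separation_axioms normedtype.

Set Implicit Arguments.
Unset Strict Implicit.
Unset Printing Implicit Defensive.

Import numFieldNormedType.Exports.

Local Open Scope classical_set_scope.
Local Open Scope quotient_scope.
Local Open Scope ring_scope.

(* Invariants valued in {0, 1, 2, ...} together with infinity live in
   [option nat], [None] standing for infinity. *)
Definition least_nat (P : nat -> Prop) : option nat :=
  if pselect (exists k, `[< P k >]) is left ex then Some (ex_minn ex) else None.

(* Subsets are regarded as spaces via [set_type], which carries the topology
   induced by the ambient space. *)
Definition homeomorphic (A B : topologicalType) : Prop :=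
  exists f : A -> B, exists g : B -> A,
    [/\ continuous f, continuous g, cancel f g & cancel g f].

Definition surface_without_boundary (R : realType) (M : topologicalType) : Prop :=
  [/\ hausdorff_space M, @second_countable M &
      forall x : M, exists (U : set M) (V : set 'rV[R]_2),
        [/\ open U, U x, open V & homeomorphic (set_type U) (set_type V)]].

(* The group is finite, hence discrete: continuity of an action amounts to
   continuity of each translation. *)
Record free_left_action (gT : finGroupType) (X : topologicalType) :=
  FreeLeftAction {
    lact :> gT -> X -> X;
    lact1 : forall x, lact 1%g x = x;
    lactM : forall g h x, lact (g * h)%g x = lact g (lact h x);
    lact_continuous : forall g, continuous (lact g);
    lact_free : forall g x, lact g x = x -> g = 1%g
  }.

Section OrbitSpace.
Context (gT : finGroupType) (X : topologicalType) (a : free_left_action gT X).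

Definition orbit_rel : rel X := fun x y => [exists g : gT, a g x == y].

Lemma orbit_rel_equiv : equiv_class_of orbit_rel.
Proof.
have sym x y : orbit_rel x y -> orbit_rel y x.
  move=> /existsP[g /eqP <-]; apply/existsP; exists (g^-1)%g.
  by rewrite -lactM mulVg lact1.
apply: EquivClass.
- by move=> x; apply/existsP; exists 1%g; rewrite lact1.
- by move=> x y; apply/idP/idP; exact: sym.
- move=> y x z /existsP[g /eqP <-] /existsP[h /eqP <-].
  by apply/existsP; exists (h * g)%g; rewrite lactM.
Qed.

Canonical orbit_equiv := EquivRelPack orbit_rel_equiv.

Definition orbit_space : topologicalType :=
  quotient_topology {eq_quot orbit_equiv}.

Definition orbit_proj : X -> orbit_space :=
  \pi_(quotient_topology {eq_quot orbit_equiv}).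

End OrbitSpace.

Definition borsuk_ulam_property (gT : finGroupType) (X : topologicalType)
    (a : free_left_action gT X) (Y : topologicalType) : Prop :=
  forall f : X -> Y, continuous f ->
    exists (x : X) (u1 u2 : gT), u1 <> u2 /\ f (a u1 x) = f (a u2 x).

(* [enum_idx] is the function h of the enumeration; indices start at 0. *)
Record enumeration (gT : finType) := Enumeration {
  enum_elt : 'I_#|gT| -> gT;
  enum_idx : gT -> 'I_#|gT|;
  enum_eltK : cancel enum_elt enum_idx;
  enum_idxK : cancel enum_idx enum_elt
}.

(* F(Y, l, 2) as a subset of the product Y^l *)
Definition config_set (Y : topologicalType) (l : nat) : set {ptws 'I_l -> Y} :=
  [set y | forall i j : 'I_l, i <> j -> y i <> y j].

Definition config (Y : topologicalType) (l : nat) : topologicalType :=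
  set_type (@config_set Y l).

Section ConfigAction.
Context (gT : finGroupType) (e : enumeration gT) (Y : topologicalType).

Definition permute_entries (g : gT) (y : {ptws 'I_#|gT| -> Y}) :
    {ptws 'I_#|gT| -> Y} :=
  fun j => y (enum_idx e (g^-1 * enum_elt e j)%g).

Lemma permute_entries_config (g : gT) (y : {ptws 'I_#|gT| -> Y}) :
  config_set y -> config_set (permute_entries g y).
Proof.
move=> dy i j ij; apply: dy => /(can_inj (enum_idxK e)) /mulgI.
by move=> /(can_inj (enum_eltK e)).
Qed.

Definition config_act (g : gT) (y : config Y #|gT|) : config Y #|gT| :=
  exist (fun z => z \in @config_set Y #|gT|) (permute_entries g (set_val y))
    (mem_set (@permute_entries_config g _ (set_valP y))).

End ConfigAction.

Definition ind2 (R : realType) (gT : finGroupType) (e : enumeration gT)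
    (X : topologicalType) (a : free_left_action gT X) : option nat :=
  least_nat (fun k => exists f : X -> config 'rV[R]_k.+1 #|gT|,
    continuous f /\ forall g x, f (a g x) = config_act e g (f x)).

Definition has_local_section (E B : topologicalType) (p : E -> B)
    (U : set B) : Prop :=
  exists s : set_type U -> E, continuous s /\ forall b, p (s b) = set_val b.

Definition secat (E B : topologicalType) (p : E -> B) : option nat :=
  least_nat (fun k => exists C : set (set B),
    [/\ (C #= `I_k)%card, \bigcup_(U in C) U = setT &
        forall U, C U -> open U /\ has_local_section p U]).

(* Main.v *)
Require Import Defs.
From HB Require Import structures.
From mathcomp Require Import all_boot all_order all_fingroup all_algebra.
From mathcomp Require Import all_classical all_reals topology.
From mathcomp Require Import separation_axioms normedtype.
From mathcomp Require Import derive trigo zify lra.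

Set Implicit Arguments.
Unset Strict Implicit.
Unset Printing Implicit Defensive.

Import Order.TTheory GRing.Theory Num.Theory.
Import numFieldNormedType.Exports.
Local Open Scope classical_set_scope.
Local Open Scope ring_scope.

(* A map X -> F(Y, l, 2) is an orbit-injective map X -> Y, so the Borsuk-Ulam
   property says exactly that ind_2 > 1. Two open sets covering M/Z_n with local
   sections give an equivariant map from M to the join Z_n * Z_n, a graph that
   maps orbit-injectively to the plane (in fact to a circle); hence
   secat >= 3. Three such sets give a map to Z_n * Z_n * Z_n, which maps
   orbit-injectively to R^3; hence ind_2 <= 2 once secat <= 3.
   For secat <= 3, take finitely many functions on the compact space M/Z_n
   supported in small open sets. By general position (maps from a surface to R^3
   can be perturbed off 0) no four of them tie anywhere, so the sets on which
   exactly k of them are maximal, k = 1, 2, 3, cover; each is a disjoint union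
   of small open sets after thickening. *)

(** * General position *)

(* Pigeonhole: among the m^q grid points of spacing eps/m two would have
   preimages in the same one of the (A m)^p cells, as soon as m > A^p. *)
Lemma lipschitz_image_gap (R : realType) (T : Type) (p q : nat) (K : set T)
    (c : 'I_p -> T -> R) (f : 'I_q -> T -> R) (L C eps : R) :
  (p < q)%N -> 0 < eps -> 0 <= L -> 0 < C ->
  (forall j x, K x -> `|c j x| < C) ->
  (forall i x y, K x -> K y ->
     `|f i x - f i y| <= L * \sum_j `|c j x - c j y|) ->
  exists v : 'I_q -> R, (forall i, `|v i| <= eps) /\
    forall x, K x -> exists i, f i x != v i.
Proof.
move=> pq eps0 L0 C0 cC fL; apply: contrapT => noGap.
(* With [A * m] cells of width [s] per coordinate, points of one cell have images closer than the
   spacing [eps / m], whatever [m] is; so [m] can be chosen after [A]. *)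
set A := (Num.truncn (2 * C * L * p%:R / eps)).+1.
have HA : 2 * C * L * p%:R < A%:R * eps.
  by rewrite -ltr_pdivrMr//; exact: truncnS_gt.
set m := (A ^ p).+1.
have m0 : (0 : R) < m%:R by rewrite ltr0n.
have A0 : (0 : R) < A%:R by rewrite ltr0n.
set N := (A * m)%N.
set s := 2 * C / N%:R.
have N0 : (0 : R) < N%:R by rewrite ltr0n muln_gt0.
have s0 : 0 < s by rewrite divr_gt0// mulr_gt0.
pose v (w : {ffun 'I_q -> 'I_m}) (i : 'I_q) : R := eps / m%:R * (w i)%:R.
have hit w : exists x, K x /\ forall i, f i x = v w i.
  apply: contrapT => nohit; apply: noGap; exists (v w); split.
    move=> i; rewrite ger0_norm; last by rewrite /v mulr_ge0// divr_ge0// ltW.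
    rewrite /v mulrAC ler_pdivrMr// ler_pM2l// ler_nat.
    exact/ltnW/ltn_ord.
  move=> x Kx; apply: contrapT => eqf; apply: nohit; exists x; split=> // i.
  by apply: contrapT => /eqP fv; apply: eqf; exists i.
pose x w := projT1 (cid (hit w)).
have Kx w : K (x w) by rewrite /x; case: cid => ? [].
have fx w i : f i (x w) = v w i by rewrite /x; case: cid => ? [].
have coordP j w : 0 <= (c j (x w) + C) / s < N%:R.
  have := cC j _ (Kx w); rewrite ltr_norml => /andP[c1 c2].
  rewrite divr_ge0 ?(ltW s0)//=; last by lra.
  rewrite ltr_pdivrMr// /s mulrC divfK ?gt_eqF//.
  lra.
have cell_subproof j w : (Num.truncn ((c j (x w) + C) / s) < N)%N.
  by have /andP[? ?] := coordP j w; rewrite truncn_lt_nat.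
pose cell w : {ffun 'I_p -> 'I_N} := [ffun j => Ordinal (cell_subproof j w)].
have /injectivePn[w1 [w2 w12 same]] : ~~ injectiveb cell.
  apply/negP => /injectiveP /leq_card; rewrite !card_ffun !card_ord.
  apply/negP; rewrite -ltnNge expnMn.
  apply: (@leq_trans (m ^ p.+1)); last by rewrite leq_pexp2l.
  by rewrite expnS ltn_pmul2r ?expn_gt0//.
have /existsP[i wi] : [exists i, w1 i != w2 i].
  rewrite -negb_forall; apply: contra w12 => /forallP ww.
  by apply/eqP/ffunP => i; exact/eqP.
have close j : `|c j (x w1) - c j (x w2)| <= s.
  have /(congr1 val) := congr1 (fun g : {ffun _ -> _} => g j) same.
  rewrite !ffunE /= => tr.
  have /andP[/truncn_itv/andP[a1 a2] _] := coordP j w1.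
  have /andP[/truncn_itv/andP[b1 b2] _] := coordP j w2.
  rewrite {}tr in a1 a2.
  have -> : c j (x w1) - c j (x w2) =
    ((c j (x w1) + C) / s - (c j (x w2) + C) / s) * s.
    by rewrite mulrBl !divfK ?gt_eqF//; lra.
  rewrite normrM (gtr0_norm s0) ger_pMl// ler_norml.
  by rewrite -natr1 in a2 b2; apply/andP; split; lra.
have := fL i _ _ (Kx w1) (Kx w2); rewrite !fx /v -mulrBr normrM.
apply/negP; rewrite -ltNge.
apply: (@le_lt_trans _ _ (L * (p%:R * s))).
  rewrite ler_wpM2l// mulr_natl.
  have -> : s *+ p = \sum_(j < p) s by rewrite sumr_const card_ord.
  exact: ler_sum.
apply: (@lt_le_trans _ _ (eps / m%:R)).
  rewrite ltr_pdivlMr// /s /N natrM invfM.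
  have -> : L * (p%:R * (2 * C * (A%:R^-1 * m%:R^-1))) * m%:R =
     2 * C * L * p%:R / A%:R * (m%:R^-1 * m%:R) by lra.
  by rewrite mulVf ?gt_eqF// mulr1 ltr_pdivrMr// [eps * _]mulrC.
rewrite gtr0_norm ?divr_gt0// ler_pMr//; last by rewrite divr_gt0.
have -> : ((w1 i)%:R - (w2 i)%:R : R) = ((w1 i)%:Z - (w2 i)%:Z)%:~R.
  by rewrite intrB.
rewrite -intr_norm ler1z -gtz0_ge1 normr_gt0 subr_eq0.
by apply: contra wi => /eqP [/val_inj ->].
Qed.

(** * Continuous real-valued functions and cutoffs *)

Section RealFunctions.
Context {R : realType} {X : topologicalType}.
Implicit Types (f g : X -> R) (K : set X).

Lemma continuous_bigsum (I : finType) (F : I -> X -> R) :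
  (forall i, continuous (F i)) -> continuous (fun x => \sum_i F i x).
Proof.
move=> cF; elim: (index_enum I) => [|i s IH] x.
  have -> : (fun y => \sum_(i <- [::]) F i y) = fun=> 0.
    by apply/funext => y; rewrite big_nil.
  exact: cvg_cst.
have -> : (fun y => \sum_(j <- i :: s) F j y) = F i \+ (fun y => \sum_(j <- s) F j y).
  by apply/funext => y; rewrite big_cons.
by apply: continuousD; [exact: cF|exact: IH].
Qed.

Lemma open_ltfun f g : continuous f -> continuous g -> open [set x | f x < g x].
Proof.
move=> cf cg; have -> : [set x | f x < g x] = (g \- f) @^-1` [set y | 0 < y].
  by apply/seteqP; split=> x /=; rewrite subr_gt0.
apply: open_comp; last exact: open_gt.
by move=> x _; apply: continuousB; [exact: cg|exact: cf].
Qed.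

Lemma closed_lefun f g : continuous f -> continuous g -> closed [set x | f x <= g x].
Proof.
move=> cf cg; rewrite -openC.
have -> : ~` [set x | f x <= g x] = [set x | g x < f x].
  by apply/seteqP; split=> x /=; rewrite ltNge => /negP.
exact: open_ltfun.
Qed.

Lemma compact_bounded_fun f K :
  compact K -> continuous f -> exists2 C : R, 0 < C & forall x, K x -> `|f x| < C.
Proof.
move=> cK cf; have /ex_strict_bound_gt0[k k0 /= kf] : bounded_set (f @` K).
  by apply: compact_bounded; apply: continuous_compact => //; exact: continuous_subspaceT.
by exists k => // x Kx; apply: kf; exists x.
Qed.

Lemma compact_pos_lbound f K : compact K -> continuous f ->
  (forall x, K x -> 0 < f x) -> exists2 d : R, 0 < d & forall x, K x -> d <= f x.
Proof.
move=> cK cf f0; have [->|K0] := eqVneq K set0; first by exists 1.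
have [|c] := compact_EVT_min _ cK (@continuous_subspaceT _ _ K f cf).
  exact/set0P.
rewrite inE => Kc fc; exists (f c); first exact: f0.
by move=> x Kx; apply: fc; rewrite inE.
Qed.

(** Clamping to [0, 1]. Applied to an affine function of [f], it turns strict bounds on [f], which
    are open conditions, into exact values on neighbourhoods. *)
Definition cutoff (t : R) : R := Num.max 0 (Num.min 1 t).

Lemma cutoff_bounds t : 0 <= cutoff t <= 1.
Proof. by rewrite /cutoff le_max lexx ge_max ler01 ge_min lexx. Qed.

Lemma cutoff0 t : t <= 0 -> cutoff t = 0.
Proof. by move=> t0; rewrite /cutoff max_l// ge_min t0 orbT. Qed.

Lemma cutoff1 t : 1 <= t -> cutoff t = 1.
Proof. by move=> t1; rewrite /cutoff min_l// max_r. Qed.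

Lemma continuous_cutoff (k l : R) f :
  continuous f -> continuous (fun x => cutoff (k * f x - l)).
Proof.
move=> cf x; apply: (@continuous_max R X (fun=> 0) _ x); first exact: cvg_cst.
apply: (@continuous_min R X (fun=> 1) _ x); first exact: cvg_cst.
by apply: cvgB; [apply: cvgM; [exact: cvg_cst|exact: cf]|exact: cvg_cst].
Qed.

End RealFunctions.

(* Inf-convolution of phi along c: psi x = inf_(y in K) (phi y + L d(c x, c y)). *)
Lemma lipschitz_approximation (R : realType) (X : topologicalType) (p : nat)
    (K : set X) (c : 'I_p -> X -> R) (phi : X -> R) (eps : R) :
  compact K -> (forall j, continuous (c j)) -> continuous phi -> 0 < eps ->
  (forall x y, K x -> K y -> (forall j, c j x = c j y) -> phi x = phi y) ->
  exists L : R, exists psi : X -> R, [/\ 0 <= L,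
    forall x y, `|psi x - psi y| <= L * \sum_j `|c j x - c j y| &
    forall x, K x -> `|psi x - phi x| <= eps].
Proof.
move=> cK cc cphi e0 inj.
have [->|/set0P[k0 Kk0]] := eqVneq K set0.
  by exists 0, (fun=> 0); split=> // x y; rewrite subrr normr0 mul0r.
have [C C0 phiC] := compact_bounded_fun cK cphi.
pose d x y := \sum_j `|c j x - c j y|.
have d0 x y : 0 <= d x y by apply: sumr_ge0.
have dxx x : d x x = 0 by apply: big1 => j _; rewrite subrr normr0.
have dC x y : d x y = d y x by apply: eq_bigr => j _; rewrite distrC.
have dtri x y z : d x z <= d x y + d y z.
  by rewrite -big_split; apply: ler_sum => j _ /=; exact: ler_distD.
(* The pairs along which [phi] drops by at least [eps]. Points with equal coordinates have equal
   [phi], so [d] is positive on this compact set and bounded below there by some [dl > 0]. *)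
pose S := (K `*` K) `&` [set z : X * X | phi z.2 <= phi z.1 - eps].
have c1 (f : X -> R) : continuous f -> continuous (fun z : X * X => f z.1).
  by move=> cf z; apply: continuous_comp; [exact: cvg_fst|exact: cf].
have c2 (f : X -> R) : continuous f -> continuous (fun z : X * X => f z.2).
  by move=> cf z; apply: continuous_comp; [exact: cvg_snd|exact: cf].
have cS : compact S.
  apply: compact_closedI; first exact: compact_setX.
  apply: closed_lefun; first exact: c2.
  by move=> z; apply: cvgB; [exact: c1|exact: cvg_cst].
have [dl dl0 dS] : exists2 dl : R, 0 < dl & forall z, S z -> dl <= d z.1 z.2.
  apply: compact_pos_lbound => //.
    apply: continuous_bigsum => j z; apply: cvg_norm.
    by apply: cvgB; [exact: c1|exact: c2].
  move=> [x y] [[/= Kx Ky] xy]; rewrite lt_neqAle d0 andbT eq_sym.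
  apply/negP; rewrite psumr_eq0// => /allP /= dxy.
  suff exy : phi x = phi y by rewrite exy in xy; lra.
  apply: inj => // j; apply/eqP; rewrite -subr_eq0 -normr_eq0.
  by apply: dxy; rewrite mem_index_enum.
(* On [S] the penalty [L * d x y] is then at least [2 * C], more than any drop of [phi] on [K]. *)
pose L := 2 * C / dl.
have L0 : 0 <= L by rewrite divr_ge0 ?mulr_ge0// ltW.
pose E x := [set phi y + L * d x y | y in K].
have E0 x : E x !=set0 by exists (phi k0 + L * d x k0), k0.
have lE x : has_lbound (E x).
  exists (- C) => _ [y Ky <-]; have := phiC _ Ky.
  have : 0 <= L * d x y by rewrite mulr_ge0.
  by rewrite ltr_norml => ? /andP[? ?]; lra.
have lip x y : inf (E x) <= inf (E y) + L * d x y.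
  rewrite -lerBlDr; apply: lb_le_inf => // _ [z Kz <-]; rewrite lerBlDr.
  apply: (@le_trans _ _ (phi z + L * d x z)); first by apply: ge_inf => //; exists z.
  rewrite -addrA lerD2l -mulrDr ler_wpM2l// addrC; exact: dtri.
exists L, (fun x => inf (E x)); split => //.
  move=> x y; rewrite ler_norml; apply/andP; split.
    by have := lip y x; rewrite dC /d; lra.
  by have := lip x y; rewrite /d; lra.
move=> x Kx; rewrite ler_norml; apply/andP; split; last first.
  rewrite lerBlDr (@le_trans _ _ (phi x))//; last by rewrite lerDr ltW.
  by apply: ge_inf => //; exists x => //; rewrite dxx mulr0 addr0.
rewrite lerBrDr addrC; apply: lb_le_inf => // _ [y Ky <-].
have Ld : 0 <= L * d x y by rewrite mulr_ge0.
have [xy|xy] := leP (phi y) (phi x - eps); last by lra.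
have /= := dS (x, y) (conj (conj Kx Ky) xy) => dlxy.
have : 2 * C <= L * d x y.
  by rewrite /L mulrAC ler_pdivlMr// ler_pM2l// mulr_gt0.
have := phiC _ Kx; have := phiC _ Ky.
by rewrite !ltr_norml => /andP[? ?] /andP[? ?]; lra.
Qed.

(** On [K], Lipschitz functions of the [p] coordinates approximate [phi]; their joint image misses a
    vector [v] with entries at most [eps / 2], and subtracting [v] removes all common zeros. *)
Lemma generic_nonvanishing (R : realType) (X : topologicalType) (p q : nat)
    (K : set X) (c : 'I_p -> X -> R) (phi : 'I_q -> X -> R) (eps : R) :
  (p < q)%N -> compact K -> (forall j, continuous (c j)) ->
  (forall i, continuous (phi i)) -> 0 < eps ->
  (forall x y, K x -> K y -> (forall j, c j x = c j y) -> x = y) ->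
  exists psi : 'I_q -> X -> R, [/\ forall i, continuous (psi i),
    forall i x, `|psi i x - phi i x| <= eps &
    forall x, K x -> exists i, psi i x != 0].
Proof.
move=> pq cK cc cphi e0 inj.
have e20 : 0 < eps / 2 by rewrite divr_gt0.
have /choice[L /choice[psi Hpsi]] : forall i, exists L : R, exists psi : X -> R,
    [/\ 0 <= L,
    forall x y, `|psi x - psi y| <= L * \sum_j `|c j x - c j y| &
    forall x, K x -> `|psi x - phi i x| <= eps / 2].
  move=> i; apply: lipschitz_approximation => // x y Kx Ky cxy.
  by rewrite (inj x y).
have /choice[C HC] : forall j, exists C : R, 0 < C /\ forall x, K x -> `|c j x| < C.
  by move=> j; have [C] := compact_bounded_fun cK (cc j); exists C.
have lipC i : continuous (psi i).
  move=> x; apply/cvgrPdist_lt => /= e e_gt0.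
  have [L0 lip _] := Hpsi i.
  have cg : continuous (fun y => (L i + 1) * \sum_j `|c j x - c j y|).
    move=> y; apply: cvgM; first exact: cvg_cst.
    apply: continuous_bigsum => j z; apply: cvg_norm.
    by apply: cvgB; [exact: cvg_cst|exact: cc].
  have : nbhs x [set y | (L i + 1) * \sum_j `|c j x - c j y| < e].
    apply: open_nbhs_nbhs; split; first by apply: open_ltfun => //; exact: cst_continuous.
    by rewrite /= big1 ?mulr0// => j _; rewrite subrr normr0.
  apply: filterS => y /=; apply: le_lt_trans; apply: (le_trans (lip _ _)).
  by rewrite ler_wpM2r ?sumr_ge0// lerDl.
have [||||v [veps vgap]] := @lipschitz_image_gap R X p q K c psi (\sum_i L i)
    (1 + \sum_j C j) (eps / 2) pq e20 _ _ _ _.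
- by apply: sumr_ge0 => i _; have [] := Hpsi i.
- by rewrite ltr_pwDl// sumr_ge0// => j _; have [/ltW] := HC j.
- move=> j x Kx; have [_ /(_ x Kx) cx] := HC j; apply: (lt_trans cx).
  rewrite (bigD1 j)//= addrCA ltrDl ltr_pwDl// sumr_ge0// => k _.
  by have [/ltW] := HC k.
- move=> i x y Kx Ky; have [_ lip _] := Hpsi i; apply: (le_trans (lip x y)).
  rewrite ler_wpM2r ?sumr_ge0// (bigD1 i)//= lerDl sumr_ge0// => k _.
  by have [] := Hpsi k.
(* [psi] is close to [phi] only on [K], while the perturbation must be small everywhere; clamping
   the difference ensures this and changes nothing on [K]. The other half of [eps] pays for [v]. *)
pose clamp (t : R) := Num.max (- (eps / 2)) (Num.min (eps / 2) t).
exists (fun i x => phi i x + clamp (psi i x - phi i x) - v i); split.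
- move=> i x; apply: cvgB; last exact: cvg_cst.
  apply: cvgD; first exact: cphi.
  apply: (@continuous_max R X (fun=> - (eps / 2)) _ x); first exact: cvg_cst.
  apply: (@continuous_min R X (fun=> eps / 2) _ x); first exact: cvg_cst.
  by apply: cvgB; [exact: lipC|exact: cphi].
- move=> i x; have := veps i; rewrite !ler_norml => /andP[? ?].
  have : - (eps / 2) <= clamp (psi i x - phi i x) <= eps / 2.
    by rewrite /clamp le_max lexx ge_max ge_min lexx /=; lra.
  by move=> /andP[? ?]; apply/andP; split; lra.
- move=> x Kx; have [i fv] := vgap x Kx; exists i.
  have -> : clamp (psi i x - phi i x) = psi i x - phi i x.
    have [_ _ /(_ x Kx)] := Hpsi i; rewrite ler_norml => /andP[? ?].
    by rewrite /clamp min_r// max_r.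
  by rewrite [phi i x + _]addrC subrK subr_eq0.
Qed.

Definition fun_within (R : realType) (J X : Type) (eps : R) (f g : J -> X -> R) :=
  forall j x, `|g j x - f j x| <= eps.

Lemma fun_withinD (R : realType) (J X : Type) (d e : R) (f g h : J -> X -> R) :
  fun_within d f g -> fun_within e g h -> fun_within (d + e) f h.
Proof.
move=> fg gh j x; rewrite -(subrK (g j x) (h j x)) -addrA addrC.
exact: le_trans (ler_normD _ _) (lerD (fg j x) (gh j x)).
Qed.

(** A finite intersection of open dense conditions is dense: the perturbations that secure later
    conditions stay within the radius on which an earlier one persists. *)
Lemma generic_conditions (R : realType) (J : Type) (X : topologicalType)
    (I : finType) (Q : I -> (J -> X -> R) -> Prop) :
  (forall i f, (forall j, continuous (f j)) -> Q i f ->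
    exists2 d : R, 0 < d & forall g, fun_within d f g -> Q i g) ->
  (forall i f (eps : R), (forall j, continuous (f j)) -> 0 < eps ->
    exists g, [/\ forall j, continuous (g j), fun_within eps f g & Q i g]) ->
  forall f (eps : R), (forall j, continuous (f j)) -> 0 < eps ->
    exists g, [/\ forall j, continuous (g j), fun_within eps f g & forall i, Q i g].
Proof.
move=> Qopen Qdense f eps cf e0.
suff [g [cg fg Qg]] : exists g, [/\ forall j, continuous (g j), fun_within eps f g &
    forall i, i \in enum I -> Q i g].
  by exists g; split=> // i; apply: Qg; rewrite mem_enum.
elim: (enum I) f eps cf e0 => [|i s IH] f eps cf e0.
  by exists f; split=> // j x; rewrite subrr normr0 ltW.
have e20 : 0 < eps / 2 by rewrite divr_gt0.
have [g [cg fg Qg]] := Qdense i f _ cf e20.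
have [d d0 dQ] := Qopen i g cg Qg.
have [|h [ch gh Qh]] := IH g (Num.min d (eps / 2)) cg.
  by rewrite lt_min d0.
have mind : Num.min d (eps / 2) <= d by rewrite ge_min lexx.
have mine : Num.min d (eps / 2) <= eps / 2 by rewrite ge_min lexx orbT.
exists h; split=> //.
  have -> : eps = eps / 2 + eps / 2 by rewrite -splitr.
  by apply: (fun_withinD fg) => j x; exact: le_trans (gh j x) mine.
move=> k; rewrite inE => /predU1P[->|/Qh//].
by apply: dQ => j x; exact: le_trans (gh j x) mind.
Qed.

(* By [generic_nonvanishing], q + 1 functions generically never coincide on a
   set of dimension p < q. *)
Lemma generic_few_ties (R : realType) (X : topologicalType) (J : finType)
    (p q : nat) (K : J -> set X) (c : J -> 'I_p -> X -> R) (f : J -> X -> R)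
    (eps : R) :
  (p < q)%N -> (forall k, compact (K k)) -> (forall k j, continuous (c k j)) ->
  (forall k x y, K k x -> K k y -> (forall j, c k j x = c k j y) -> x = y) ->
  (forall j, continuous (f j)) -> 0 < eps ->
  exists g, [/\ forall j, continuous (g j), fun_within eps f g &
    forall k x t, K k x -> (#|[pred j | g j x == t]| <= q)%N].
Proof.
move=> pq cK cc inj cf e0.
(* One condition for each [K k] and each choice [w] of [q + 1] distinct functions: they never all
   agree on [K k]. These are finitely many, so [generic_conditions] applies. *)
pose Q (kw : J * {ffun 'I_q.+1 -> J}) (g : J -> X -> R) := injective kw.2 ->
  forall x, K kw.1 x -> exists i, g (kw.2 ord0) x != g (kw.2 (lift ord0 i)) x.
have [||g [cg fg Qg]] := @generic_conditions R J X _ Q _ _ f eps cf e0; last first.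
- exists g; split=> // k x t Kx; rewrite leqNgt; apply/negP => ltq.
  pose w : {ffun 'I_q.+1 -> J} := [ffun i => enum_val (widen_ord ltq i)].
  have winj : injective w.
    by move=> i j; rewrite !ffunE => /enum_val_inj /(congr1 val) /= /val_inj.
  have [i] := Qg (k, w) winj x Kx.
  have wt j : g (w j) x = t.
    by apply/eqP; have := enum_valP (widen_ord ltq j); rewrite inE ffunE.
  by rewrite /= !wt eqxx.
- move=> [k w] g eta cg eta0.
  have [winj|nw] := pselect (injective w); last first.
    by exists g; split=> // j x; rewrite subrr normr0 ltW.
  have [|psi [cpsi wpsi npsi]] := @generic_nonvanishing R X p q (K k) (c k)
    (fun i => g (w (lift ord0 i)) \- g (w ord0)) eta pq (cK k) (cc k) _ eta0 (inj k).
    by move=> i x; apply: continuousB; exact: cg.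
  (* [g (w ord0)] is kept, and the [q] other chosen functions are moved so that their differences
     with it become the [psi i]. *)
  exists (fun j => if [pick i | w (lift ord0 i) == j] is Some i
                   then psi i \+ g (w ord0) else g j); split.
  + move=> j; case: pickP => [i _|_]; last exact: cg.
    by move=> x; apply: continuousD; [exact: cpsi|exact: cg].
  + move=> j x; case: pickP => [i /eqP <-|_]; last by rewrite subrr normr0 ltW.
    have /= := wpsi i x; rewrite ler_norml => /andP[? ?].
    by rewrite ler_norml; apply/andP; split; rewrite /=; lra.
  + move=> _ x /= Kx; have [i psix] := npsi x Kx; exists i.
    case: pickP => [i0 /eqP /winj|_].
      by move/eqP; rewrite eq_sym (negPf (neq_lift _ _)).
    case: pickP => [i0 /eqP /winj /lift_inj ->|/(_ i)]; last by rewrite eqxx.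
    by rewrite /= -subr_eq0 opprD addrCA subrr addr0 oppr_eq0.
- move=> [k w] g cg Qg.
  have [winj|nw] := pselect (injective w); last by exists 1 => // h _ /nw.
  pose s x := \sum_i `|g (w ord0) x - g (w (lift ord0 i)) x|.
  have [||d d0 dK] := @compact_pos_lbound R X s (K k) (cK k).
  + apply: continuous_bigsum => i x; apply: cvg_norm.
    by apply: cvgB; exact: cg.
  + move=> x Kx; have [i neq] := Qg winj x Kx.
    rewrite /s (bigD1 i)//= ltr_pwDl ?sumr_ge0//.
    by rewrite normr_gt0 subr_eq0.
  (* A full tie of [h] would bound each of the [q] differences of [g] by twice this radius, hence
     their sum [s x] by [q * d / (q + 1) < d]. *)
  exists (d / (2 * q.+1%:R)); first by rewrite divr_gt0// mulr_gt0// ltr0n.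
  move=> h gh _ x /= Kx; apply: contrapT => noi.
  have heq i : h (w ord0) x = h (w (lift ord0 i)) x.
    by apply: contrapT => /eqP ne; apply: noi; exists i.
  have : s x <= \sum_(i < q) (d / q.+1%:R).
    apply: ler_sum => i _; have h1 := gh (w ord0) x; have h2 := gh (w (lift ord0 i)) x.
    have -> : d / q.+1%:R = d / (2 * q.+1%:R) + d / (2 * q.+1%:R).
      by rewrite -mulrDl -mulr2n -[d *+ 2]mulr_natl -mulf_div divff ?mul1r ?pnatr_eq0//.
    rewrite -heq in h2; move: h1 h2; set e := d / _.
    rewrite !ler_norml => /andP[a a0] /andP[b b0].
    by apply/andP; split; lra.
  rewrite sumr_const card_ord => sx; have := le_trans (dK x Kx) sx.
  apply/negP; rewrite -ltNge -[_ *+ q]mulr_natr -mulrA gtr_pMr// mulrC.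
  by rewrite ltr_pdivrMr ?ltr0n// mul1r ltr_nat.
Qed.

(** * Orbit spaces *)

Lemma eq_near_continuous (X Y : topologicalType) (f g : X -> Y) (x : X) :
  (\forall y \near x, f y = g y) -> {for x, continuous g} -> {for x, continuous f}.
Proof.
move=> fg cg; have fx : f x = g x by exact: nbhs_singleton fg.
rewrite /prop_for /continuous_at fx; apply: cvg_trans cg; apply: near_eq_cvg.
by apply: filterS fg => y ->.
Qed.

Lemma valL_continuous (X Y : topologicalType) (U : set X) (y : Y) (f : set_type U -> Y) :
  open U -> continuous f -> forall x, U x -> {for x, continuous (valL_ y f)}.
Proof.
move=> oU /subspace_valL_continuousP'-/(_ y) cf x Ux.
by rewrite continuous_open_subspace// in cf; apply: cf; rewrite inE.
Qed.

Lemma valL_val (X Y : Type) (U : set X) (y : Y) (f : set_type U -> Y) (u : set_type U) :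
  valL_ y f (set_val u) = f u.
Proof. exact: (congr1 (@^~ u) (@valLK _ _ y U f)). Qed.

Lemma set_val_ex (X : Type) (U : set X) x : U x -> exists u : set_type U, set_val u = x.
Proof. by move=> Ux; exists (exist _ x (mem_set Ux)). Qed.

Lemma open_cover_finite (X : topologicalType) (I : choiceType) (U : I -> set X) :
  compact [set: X] -> (forall i, open (U i)) -> (forall x, exists i, U i x) ->
  exists (J : finType) (f : J -> I), forall x, exists j, U (f j) x.
Proof.
move=> cX oU cov; have [[x0 _]|nX] := pselect (exists x : X, True); last first.
  by exists void, (fun v : void => match v with end) => x; case: nX; exists x.
pose X' : ptopologicalType :=
  HB.pack (Topological.sort X) (Topological.class X) (isPointed.Build X x0).
have : @cover_compact X' setT by rewrite -compact_cover.
move=> /(_ I setT U (fun i _ => oU i)) [|D _ DU].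
  by move=> x _; have [i Ui] := cov x; exists i.
exists (seq_sub (finmap.enum_fset D)), (fun i => ssval i) => x.
have [i /= Di Uix] := DU x Logic.I.
by exists (SeqSub Di).
Qed.

Lemma urysohn_function (R : realType) (X : topologicalType) (A B : set X) :
  hausdorff_space X -> compact [set: X] -> closed A -> closed B -> A `&` B = set0 ->
  exists f : X -> R, [/\ continuous f, forall x, 0 <= f x <= 1,
    forall x, A x -> f x = 0 & forall x, B x -> f x = 1].
Proof.
move=> hX cX cA cB AB.
have /(@normal_separatorP R) := compact_normal hX cX.
move=> /(_ _ _ cA cB AB)/(@uniform_separatorP _ R)[f [cf f01 fA fB]].
exists f; split=> // x.
- by have := f01 (f x); rewrite /= in_itv /=; apply; exists x.
- by move=> Ax; apply: fA; exists x.
- by move=> Bx; apply: fB; exists x.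
Qed.

Section OrbitProjection.
Context {gT : finGroupType} {X : topologicalType} (a : free_left_action gT X).
Local Notation B := (orbit_space a).
Local Notation p := (orbit_proj a).

Lemma orbit_projP x y : p x = p y <-> exists g, a g x = y.
Proof.
split=> [/(eqmodP (orbit_equiv a))|[g agx]].
  by rewrite /= /orbit_rel => /existsP[g /eqP]; exists g.
by apply/(eqmodP (orbit_equiv a)); apply/existsP; exists g; exact/eqP.
Qed.

Lemma orbit_proj_lact g x : p (a g x) = p x.
Proof. by apply/orbit_projP; exists g^-1%g; rewrite -lactM mulVg lact1. Qed.

Lemma orbit_proj_surj b : exists x, p x = b.
Proof. by exists (generic_quotient.repr b); rewrite /orbit_proj reprK. Qed.

Lemma lact_eq g h x : a g x = a h x -> g = h.
Proof.
move=> /(congr1 (a h^-1%g)); rewrite -!lactM mulVg lact1 => /lact_free.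
by move/(congr1 (mulg h)); rewrite mulgA mulgV mul1g mulg1.
Qed.

Lemma orbit_proj_continuous : continuous p.
Proof. exact: pi_continuous. Qed.

Lemma orbit_proj_open A : open A -> open (p @` A).
Proof.
move=> oA; suff : open (p @^-1` (p @` A)) by [].
have -> : p @^-1` (p @` A) = \bigcup_(g in [set: gT]) (a g @^-1` A).
  apply/seteqP; split=> [x /= [y Ay /esym/orbit_projP[g agx]]|x [g _ /= Agx]].
    by exists g => //=; rewrite agx.
  by exists (a g x) => //; rewrite orbit_proj_lact.
apply: bigcup_open => g _; apply: open_comp => // x _; exact: lact_continuous.
Qed.

Lemma orbit_compact : compact [set: X] -> compact [set: B].
Proof.
move=> cX; have -> : [set: B] = p @` setT.
  by apply/seteqP; split=> // b _; have [x <-] := orbit_proj_surj b; exists x.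
apply: continuous_compact => //; apply: continuous_subspaceT.
exact: orbit_proj_continuous.
Qed.

Lemma orbit_descend (Z : topologicalType) (f : X -> Z) : continuous f ->
  (forall g x, f (a g x) = f x) ->
  exists f' : B -> Z, continuous f' /\ forall x, f' (p x) = f x.
Proof.
move=> cf inv.
have fE x y : p x = p y -> f x = f y by move=> /orbit_projP[g <-]; rewrite inv.
exists (f \o generic_quotient.repr); split.
  by apply: repr_comp_continuous => // x y /eqP/fE ->.
by move=> x /=; apply: fE; rewrite /orbit_proj reprK.
Qed.

(** [A] meets each orbit at most once; an open slice is a sheet of the covering [p]. *)
Definition slice (A : set X) := forall x g, A x -> A (a g x) -> g = 1%g.

(** By freeness, each [g != 1] moves [x], so some neighbourhood of [x] is disjoint from its
    translate by [g]; intersect these over the finite group. *)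
Lemma slice_exists x : hausdorff_space X -> exists O, [/\ open O, O x & slice O].
Proof.
rewrite open_hausdorff => hX.
have sep (g : gT) : exists O, [/\ open O, O x & g != 1%g -> forall y, O y -> ~ O (a g y)].
  have [->|g1] := eqVneq g 1%g; first by exists setT; split=> //; exact: openT.
  have [|[C D] /= [xC gxD] [oC oD CD]] := hX x (a g x).
    by apply: contra g1 => /eqP/esym/lact_free ->.
  exists (C `&` (a g @^-1` D)); split.
  - apply: openI => //; apply: open_comp => // y _; exact: lact_continuous.
  - by rewrite inE in xC; rewrite inE in gxD; split.
  - move=> _ y [_ /= Dy] [Cy _]; move/eqP: CD; apply/eqP/set0P.
    by exists (a g y).
have [O HO] := choice sep.
exists [set y | forall g, O g y]; split.
- rewrite openE => y Oy; apply: filter_forall => g; apply: open_nbhs_nbhs.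
  by split=> //; have [] := HO g.
- by move=> g; have [] := HO g.
- move=> y g Oy Ogy; apply/eqP; apply: contrapT => /negP g1.
  by have [_ _ /(_ g1 y (Oy g))] := HO g; apply; exact: Ogy.
Qed.

(** [p] is open, and injective on [A], so the inverse of its restriction is continuous. *)
Lemma slice_local_section A : open A -> slice A -> has_local_section p (p @` A).
Proof.
move=> oA slA.
have ex (b : set_type (p @` A)) : exists x, A x /\ p x = set_val b.
  by have [x Ax px] := set_valP b; exists x.
have [s sP] := choice ex.
exists s; split=> [|b]; last by have [] := sP b.
apply/continuousP => D oD.
exists (p @` (A `&` D)); first by apply: orbit_proj_open; exact: openI.
apply/seteqP; split=> [b /= [x [Ax Dx] px]|b /= Db]; last first.
  by have [Asb <-] := sP b; exists (s b).
have [Asb psb] := sP b; rewrite -px in psb.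
have /orbit_projP[g gsb] := psb.
have g1 : g = 1%g by apply: (slA (s b)) => //; rewrite gsb.
by rewrite -gsb g1 lact1 in Dx.
Qed.

(** A local section trivialises the covering over [U]: [h x] is the unique group element carrying
    the section point over [p x] to [x]. Off [U] it is arbitrary. *)
Lemma local_section_label (U : set B) : hausdorff_space X -> open U ->
  has_local_section p U -> exists h : X -> gT,
    (forall x g, U (p x) -> h (a g x) = (g * h x)%g) /\
    (forall x, U (p x) -> \forall y \near x, h y = h x).
Proof.
rewrite open_hausdorff => hX oU [s [cs ps]].
have ex x : exists g : gT, forall u : set_type U, set_val u = p x -> a g (s u) = x.
  have [Upx|nU] := pselect (U (p x)); last first.
    by exists 1%g => u ux; case: nU; rewrite -ux; exact: set_valP.
  have [u ux] := set_val_ex Upx.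
  have /orbit_projP[g gx] : p (s u) = p x by rewrite ps.
  by exists g => v vx; rewrite (_ : v = u)//; apply: val_inj; rewrite /= -!set_valE vx.
have [h hP] := choice ex.
have hS x u g : set_val u = p x -> a g (s u) = x -> h x = g.
  by move=> ux gx; apply: (@lact_eq _ _ (s u)); rewrite gx hP.
exists h; split=> x.
  move=> g Upx; have [u ux] := set_val_ex Upx.
  by apply: (hS _ u); rewrite ?orbit_proj_lact// lactM hP.
move=> Upx; pose s' : B -> X := valL_ x s.
have s'E y u : set_val u = p y -> s' (p y) = s u by move=> <-; rewrite /s' valL_val.
have cs' : {for x, continuous (s' \o p)}.
  apply: continuous_comp; first exact: orbit_proj_continuous.
  exact: valL_continuous.
have nearU : \forall y \near x, U (p y).
  exact: (@orbit_proj_continuous x U (open_nbhs_nbhs (conj oU Upx))).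
(* For each of the finitely many [g != h x], the point [a g (s' (p x))] differs from [x], and
   disjoint neighbourhoods keep them apart nearby; only the label [h x] is left. *)
have nearne : \forall y \near x, forall g, g != h x -> a g (s' (p y)) <> y.
  apply: filter_forall => g.
  have [->|gh] := eqVneq g (h x); first by near=> y.
  have [u ux] := set_val_ex Upx.
  have [|[C D] /= [xC gxD] [oC oD CD]] := hX x (a g (s u)).
    by apply: contra gh => /eqP gx; rewrite (hS x u g).
  rewrite !inE in xC gxD.
  have : \forall y \near x, D (a g (s' (p y))).
    have : {for x, continuous (a g \o (s' \o p))}.
      by apply: continuous_comp => //; exact: lact_continuous.
    by move=> /(_ D); apply; apply: open_nbhs_nbhs; split => //=; rewrite (s'E x u).
  have : \forall y \near x, C y by apply: open_nbhs_nbhs.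
  apply: filterS2 => y Cy Dy _ yE; rewrite yE in Dy.
  by move/eqP: CD; apply/eqP/set0P; exists y.
apply: filterS2 nearU nearne => y Upy /(_ (h y)) ne.
have [u uy] := set_val_ex Upy.
by apply/eqP; apply: contrapT => /negP /ne; rewrite (s'E y u)// hP.
Unshelve. all: by end_near. Qed.

End OrbitProjection.

(** * Covers of the orbit space by few local sections *)

(** The trace of an atlas used for general position: coordinates that separate the points of [U],
    taken as total functions so that they can later be multiplied by bump functions. *)
Definition locally_injects (R : realType) (p : nat) (X : topologicalType) :=
  forall x : X, exists (U : set X) (c : 'I_p -> X -> R), [/\ open U, U x,
    forall j y, U y -> {for y, continuous (c j)} &
    forall y z, U y -> U z -> (forall j, c j y = c j z) -> y = z].

Lemma surface_locally_injects (R : realType) (X : topologicalType) :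
  surface_without_boundary R X -> locally_injects R 2 X.
Proof.
move=> [_ _ charts] x; have [U [V [oU Ux oV [f [g [cf cg fK gK]]]]]] := charts x.
exists U, (fun j y => valL_ 0 (fun u => set_val (f u)) y ord0 j); split=> //.
  move=> j y Uy.
  apply: (@continuous_comp _ _ _ (valL_ 0 (fun u => set_val (f u)))
    (fun v : 'rV[R]_2 => v ord0 j)); last exact: coord_continuous.
  apply: valL_continuous => // u; apply: continuous_comp; first exact: cf.
  exact: initial_continuous.
move=> y z Uy Uz uv.
have [u uy] := set_val_ex Uy; have [v vz] := set_val_ex Uz.
rewrite -uy -vz in uv *.
congr set_val; apply: (can_inj fK); apply: val_inj.
by apply/rowP => j; have := uv j; rewrite !valL_val.
Qed.

Section Cover.
Context {R : realType} {gT : finGroupType} {X : topologicalType}.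
Context (a : free_left_action gT X).
Hypotheses (X_hausdorff : hausdorff_space X) (X_compact : compact [set: X]).
Local Notation B := (orbit_space a).
Local Notation p := (orbit_proj a).

(** Functions supported in a sheet [O] are summed over the group and descend to the orbit space; at
    a point of [O] only the identity term of each sum is nonzero. *)
Lemma orbit_chart d (x : X) : locally_injects R d X ->
  exists (O : set X) (b : B -> R) (c : 'I_d -> B -> R),
    [/\ open O /\ slice a O, continuous b /\ 1 < b (p x), forall j, continuous (c j),
      forall y, 0 < b (p y) -> exists g, O (a g y) &
      forall y z, 1 <= b y -> 1 <= b z -> (forall j, c j y = c j z) -> y = z].
Proof.
move=> /(_ x)[U [c [oU Ux cc cinj]]].
have [S [oS Sx slS]] := slice_exists a x X_hausdorff.
pose O := U `&` S.
have oO : open O by exact: openI.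
have slO : slice a O by move=> y g [_ Sy] [_ Sgy]; exact: slS Sy Sgy.
have [|||u [cu u01 u0 u1]] := @urysohn_function R X (~` O) [set x] X_hausdorff X_compact.
- exact: open_closedC.
- exact/accessible_closed_set1/hausdorff_accessible.
- by apply/seteqP; split=> // y [nO yx]; apply: nO; rewrite yx.
have uge0 y : 0 <= u y by have /andP[] := u01 y.
have ugt0 y : 0 < u y -> O y.
  by move=> uy; apply: contrapT => /u0 e; rewrite e ltxx in uy.
have ux1 : u x = 1 by exact: u1.
(* [w] vanishes where [u < 1/4], so [w * c j] extends continuously by zero outside [O]. It is 1
   where [1/2 <= u], which on [O] means [1 <= b] because [b = 2 * u] there. *)
pose w y := cutoff (4 * u y - 1).
have cw : continuous w by exact: continuous_cutoff.
have w0 y : u y < 1/4 -> w y = 0 by move=> uy; apply: cutoff0; lra.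
have w1 y : 1/2 <= u y -> w y = 1 by move=> uy; apply: cutoff1; lra.
have cwc j : continuous (fun y => w y * c j y).
  move=> y; have [Oy|nO] := pselect (O y).
    by apply: continuousM; [exact: cw|apply: cc; case: Oy].
  apply: (@eq_near_continuous _ _ _ (fun=> 0)); last exact: cst_continuous.
  have : nbhs y [set z | u z < 1/4].
    apply: open_nbhs_nbhs; split; first by apply: open_ltfun => //; exact: cst_continuous.
    by rewrite /= u0//; lra.
  by apply: filterS => z /= /w0 ->; rewrite mul0r.
have csum (f : X -> R) : continuous f -> exists f' : B -> R,
    continuous f' /\ forall y, f' (p y) = \sum_g f (a g y).
  move=> cf; apply: orbit_descend.
    apply: continuous_bigsum => g y.
    by apply: continuous_comp; [exact: lact_continuous|exact: cf].
  move=> h y; rewrite [RHS](reindex_inj (mulIg h)).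
  by apply: eq_bigr => g _; rewrite lactM.
have [b [cb bE]] : exists b : B -> R, continuous b /\
    forall y, b (p y) = \sum_g 2 * u (a g y).
  by apply: (csum (fun y => 2 * u y)) => y; apply: cvgM; [exact: cvg_cst|exact: cu].
have [c' /all_and2[cc' c'E]] := choice (fun j => csum _ (cwc j)).
have other y g : O y -> g != 1%g -> u (a g y) = 0.
  by move=> Oy g1; apply: u0 => Ogy; move: g1; rewrite (slO y g)// eqxx.
have bO y : O y -> b (p y) = 2 * u y.
  move=> Oy; rewrite bE (bigD1 1%g)//= lact1 big1 ?addr0// => g g1.
  by rewrite other// mulr0.
have bgt0 y : 0 < b (p y) -> exists g, O (a g y).
  move=> b0; apply: contrapT => nO; move: b0; rewrite bE big1 ?ltxx// => g _.
  by rewrite u0 ?mulr0// => Og; apply: nO; exists g.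
have c'O j y : O y -> 1 <= b (p y) -> c' j (p y) = c j y.
  move=> Oy; rewrite bO// => b1; rewrite c'E (bigD1 1%g)//= lact1 w1; last by lra.
  rewrite mul1r big1 ?addr0// => g g1.
  by rewrite w0 ?mul0r// other//; lra.
have rep z : 1 <= b z -> exists2 y, O y & z = p y.
  have [y <-] := orbit_proj_surj z => b1.
  have [|g Og] := bgt0 y; first exact: lt_le_trans b1.
  by exists (a g y); rewrite ?orbit_proj_lact.
exists O, b, c'; split=> //.
  by split=> //; rewrite bO ?ux1; [lra|split].
move=> y z by1 bz1.
have [y' Oy yE] := rep y by1; have [z' Oz zE] := rep z bz1; subst y z => cyz.
congr (p _); apply: cinj => [||j]; [by case: Oy|by case: Oz|].
by rewrite -!c'O.
Qed.

(* If at most d + 1 of the functions g j can tie, the sets where exactly the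
   indices in S attain the maximum, thickened to W S, are pairwise disjoint
   among the S of a given cardinality. *)
Lemma local_section_cover d : locally_injects R d X ->
  exists U : 'I_d.+1 -> set B,
    (forall k, open (U k) /\ has_local_section p (U k)) /\
    forall b, exists k, U k b.
Proof.
move=> emb; have /choice[O /choice[be /choice[ch Hch]]] := fun x => orbit_chart x emb.
have [|y|J [ctr Jcov]] := @open_cover_finite B X (fun x => [set y | 1 < be x y])
  (orbit_compact (a := a) X_compact).
- move=> x; have [_ [cb _] _ _ _] := Hch x.
  by apply: open_ltfun => //; exact: cst_continuous.
- by have [x <-] := orbit_proj_surj y; exists x; have [_ [_]] := Hch x.
pose f j := be (ctr j).
have cf j : continuous (f j) by have [_ []] := Hch (ctr j).
(* Every point has some [f j > 1], so with tolerance 1/4 the largest [g j] is at least 3/4 there,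
   and an index [i] attaining it has [f i >= 1/2 > 0]: the orbit meets the sheet of [i]. *)
have [|k||||g [cg fg ties]] := @generic_few_ties R B J d d.+1
   (fun j => [set y | 1 <= f j y])
   (fun j => ch (ctr j)) f (1/4) (ltnSn d).
- move=> k; rewrite -[X in compact X]setTI.
  apply: compact_closedI; first exact: orbit_compact.
  by apply: closed_lefun => //; exact: cst_continuous.
- by have [_ _] := Hch (ctr k).
- by move=> k y z; have [_ _ _ _] := Hch (ctr k); apply.
- exact: cf.
- by lra.
pose W (S : {set J}) := [set y | forall i, i \in S ->
  1/2 < g i y /\ forall j, j \notin S -> g j y < g i y].
have oW S : open (W S).
  rewrite openE => y Wy.
  apply: (@filter_forall B J (fun i z => i \in S ->
    1/2 < g i z /\ forall j, j \notin S -> g j z < g i z) (nbhs y) _) => i.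
  have [iS|niS] := boolP (i \in S); last by near=> z.
  have [gi gij] := Wy i iS.
  have n1 : \forall z \near y, 1/2 < g i z.
    by apply: open_nbhs_nbhs; split=> //; apply: open_ltfun => //; exact: cst_continuous.
  have n2 : \forall z \near y, forall j, j \notin S -> g j z < g i z.
    apply: (@filter_forall B J (fun j z => j \notin S -> g j z < g i z) (nbhs y) _) => j.
    have [jS|njS] := boolP (j \in S); first by near=> z.
    have : \forall z \near y, g j z < g i z.
      by apply: open_nbhs_nbhs; split; [exact: open_ltfun|exact: gij].
    by apply: filterS.
  by apply: filterS2 n1 n2.
have Wdisj (S T : {set J}) y : #|S| = #|T| -> W S y -> W T y -> S = T.
  move=> ST WS WT; apply/eqP; rewrite eqEcard -ST leqnn andbT.
  apply/fintype.subsetP => i iS; apply: contrapT => /negP niT.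
  have : ~~ (T \subset S).
    apply/negP => TS; have /eqP TSE : T == S by rewrite eqEcard TS ST leqnn.
    by rewrite TSE iS in niT.
  move=> /fintype.subsetPn[j jT njS].
  have [_ /(_ j njS) ji] := WS i iS; have [_ /(_ i niT) ij] := WT j jT.
  by have := lt_trans ji ij; rewrite ltxx.
(* Over [W S] the sheet of one picked index of [S] is used. By [Wdisj] the union over sets of one
   size is again a slice. Sizes start at 1, hence [k.+1]. *)
pose A (k : 'I_d.+1) := \bigcup_(Si in [set Si : {set J} * J |
    #|Si.1| = k.+1 /\ [pick i in Si.1] = Some Si.2])
  (p @^-1` W Si.1 `&` O (ctr Si.2)).
have oA k : open (A k).
  apply: bigcup_open => Si _; apply: openI.
    by apply: open_comp => // x _; exact: orbit_proj_continuous.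
  by have [[]] := Hch (ctr Si.2).
have slA k : slice a (A k).
  move=> y h [[S i] /= [cS Si] [/= WS Oi]] [[T j] /= [cT Tj] [/= WT Oj]].
  rewrite orbit_proj_lact in WT.
  have ST : S = T by apply: Wdisj WS WT; rewrite cS cT.
  have ij : i = j by move: Si Tj; rewrite ST => -> [].
  have [[_ sl] _ _ _ _] := Hch (ctr i).
  by apply: (sl y) => //; rewrite ij.
exists (fun k => p @` A k); split=> [k|b].
  by split; [exact: orbit_proj_open|exact: slice_local_section].
have [j0 bj0] := Jcov b.
have [jm _ jmax] := @Order.TotalTheory.arg_maxP _ _ J j0 xpredT (fun j => g j b) isT.
pose S := [set j | g j b == g jm b]%SET.
have jmS : jm \in S by rewrite inE.
have S3 : (#|S| <= d.+1)%N.
  by rewrite cardsE; apply: (ties j0); exact: ltW bj0.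
have gm : 3/4 <= g jm b.
  have := jmax j0 isT; have := fg j0 b; rewrite ler_norml => /andP[h1 _] h2.
  by rewrite /f /= in h1; rewrite /= in bj0 h2; lra.
have WS : W S b.
  move=> i; rewrite inE => /eqP ->; split; first by lra.
  by move=> j; rewrite inE => jS; rewrite lt_neqAle jS; exact: jmax.
case Ei : [pick i in S] => [i|]; last by move: Ei; case: pickP => // /(_ jm); rewrite jmS.
have iS : i \in S by move: Ei; case: pickP => // ? ? [<-].
have [y yb] := orbit_proj_surj b.
have [h Oh] : exists h, O (ctr i) (a h y).
  have [_ _ _ + _] := Hch (ctr i); apply; rewrite yb.
  move: iS; rewrite inE => /eqP gi; have := fg i b; rewrite gi ler_norml /f => /andP[_ ?].
  by lra.
have S0 : (0 < #|S|)%N by apply/card_gt0P; exists jm.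
have kS : (#|S|.-1 < d.+1)%N by rewrite prednK.
exists (Ordinal kS), (a h y); last by rewrite orbit_proj_lact.
exists (S, i); first by rewrite /= prednK.
by split=> //=; rewrite orbit_proj_lact yb.
Unshelve. all: by end_near. Qed.

End Cover.

(** * Orbit-injective maps to the plane and to space *)

Section Circle.
Context {R : realType}.
Implicit Types (u v s t : R).

(** The hypotheses give [cos w = 1] for [w = u - v], hence [sin (w / 2) = 0], while the sine is
    positive strictly between 0 and [pi]. *)
Lemma cos_sin_inj u v : `|u - v| < pi *+ 2 -> cos u = cos v -> sin u = sin v -> u = v.
Proof.
move=> uv cuv suv; apply/eqP; rewrite -subr_eq0; set w := u - v in uv *.
have cw : cos w = 1 by rewrite cosB cuv suv -!expr2 cos2Dsin2.
have wE : w = (w / 2) *+ 2 by rewrite -mulr_natr divfK ?pnatr_eq0.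
have s2 : sin (w / 2) = 0.
  have := cos2Dsin2 (w / 2); move: cw; rewrite wE cos_mulr2n -wE => c1 c2.
  by apply/eqP; rewrite -sqrf_eq0; apply/eqP; lra.
move: uv; rewrite ltr_norml => /andP[w1 w2].
have [w0|w0|w0] := ltgtP w 0; last exact/eqP.
  have : 0 < sin (- (w / 2)) by apply: sin_gt0_pi; apply/andP; split; lra.
  by rewrite sinN s2 oppr0 ltxx.
have : 0 < sin (w / 2) by apply: sin_gt0_pi; apply/andP; split; lra.
by rewrite s2 ltxx.
Qed.

Variable N : nat.
Hypothesis N_gt0 : (0 < N)%N.

(* The position on the circle at s steps past the k-th vertex of a regular N-gon. *)
Definition angle (k : nat) s : R := pi *+ 2 / N%:R * (k%:R + s).

Let N0 : (0 : R) < N%:R. Proof. by rewrite ltr0n. Qed.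

Lemma angle_inj k l s : (k < N)%N -> (l < N)%N ->
  cos (angle k s) = cos (angle l s) -> sin (angle k s) = sin (angle l s) -> k = l.
Proof.
move=> kN lN ckl skl; have pi20 : (0 : R) < pi *+ 2 by rewrite pmulrn_rgt0// pi_gt0.
have : angle k s = angle l s.
  apply: cos_sin_inj => //; rewrite /angle -mulrBr opprD addrACA subrr addr0.
  rewrite normrM gtr0_norm ?divr_gt0// mulrAC ltr_pdivrMr// ltr_pM2l//.
  have : (k%:R : R) < N%:R by rewrite ltr_nat.
  have : (l%:R : R) < N%:R by rewrite ltr_nat.
  have : (0 : R) <= k%:R by [].
  have : (0 : R) <= l%:R by [].
  by move=> ? ? ? ?; rewrite ltr_norml; apply/andP; split; lra.
have u0 : pi *+ 2 / N%:R != 0 :> R by rewrite gt_eqF// divr_gt0.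
by move/(mulfI u0)/addIr/eqP; rewrite eqr_nat => /eqP.
Qed.

Lemma angle_full_turn k s : angle (k + N) s = angle k s + pi *+ 2.
Proof. by rewrite /angle natrD addrAC mulrDr divfK ?gt_eqF. Qed.

(** Whole steps lead from vertex to vertex, with labels added modulo [N], as in the cyclic group. *)
Lemma angle_modn k d : (k < N)%N -> (d < N)%N ->
  cos (angle k d%:R) = cos (angle ((k + d) %% N) 0) /\
  sin (angle k d%:R) = sin (angle ((k + d) %% N) 0).
Proof.
move=> kN dN; have -> : angle k d%:R = angle (k + d) 0 by rewrite /angle natrD addr0.
have [kd|Nkd] := ltnP (k + d) N; first by rewrite modn_small.
rewrite -{1 3}(subnK Nkd) angle_full_turn cosD2pi sinD2pi.
have -> : ((k + d) %% N = k + d - N)%N; last by [].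
by rewrite -{1}(subnK Nkd) modnDr modn_small//; lia.
Qed.

Lemma continuous_angle (X : topologicalType) (k : nat) (f : X -> R) (x : X) :
  {for x, continuous f} ->
  {for x, continuous (fun y => cos (angle k (f y)))} /\
  {for x, continuous (fun y => sin (angle k (f y)))}.
Proof.
move=> cf; have ca : {for x, continuous (fun y => angle k (f y))}.
  by apply: cvgM; [exact: cvg_cst|apply: cvgD; [exact: cvg_cst|exact: cf]].
split.
  by apply: (continuous_comp (g := cos) ca); exact: continuous_cos.
by apply: (continuous_comp (g := sin) ca); exact: continuous_sin.
Qed.

End Circle.

(** * Separating functions on the orbit space *)

Section OrbitUrysohn.
Context {R : realType} {gT : finGroupType} {X : topologicalType}.
Context (a : free_left_action gT X).
Hypotheses (X_hausdorff : hausdorff_space X) (X_compact : compact [set: X]).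
Local Notation B := (orbit_space a).
Local Notation p := (orbit_proj a).

(** A Urysohn function upstairs is averaged over the group and descends; a cutoff then makes the
    values 0 and 1 hold near the closed sets, as gluing requires. *)
Lemma orbit_urysohn (A C : set B) : closed A -> closed C -> A `&` C = set0 ->
  exists t : B -> R, [/\ continuous t, forall b, 0 <= t b <= 1,
    forall b, A b -> \forall b' \near b, t b' = 0 &
    forall b, C b -> \forall b' \near b, t b' = 1].
Proof.
move=> cA cC AC.
have cp (D : set B) : closed D -> closed (p @^-1` D).
  by move=> cD; apply: preimage_closed => // x _; exact: orbit_proj_continuous.
have [|u [cu u01 uA uC]] :=
    @urysohn_function R X _ _ X_hausdorff X_compact (cp _ cA) (cp _ cC).
  by rewrite -preimage_setI AC preimage_set0.
pose m : R := #|gT|%:R.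
have m0 : 0 < m by rewrite ltr0n; apply/card_gt0P; exists 1%g.
have [v [cv vE]] : exists v : B -> R, continuous v /\
    forall x, v (p x) = m^-1 * \sum_g u (a g x).
  apply: (orbit_descend (f := fun x => m^-1 * \sum_g u (a g x))).
    move=> x; apply: cvgM; first exact: cvg_cst.
    apply: continuous_bigsum => g y.
    by apply: continuous_comp; [exact: lact_continuous|exact: cu].
  move=> h x; rewrite [in RHS](reindex_inj (mulIg h)); congr (_ * _).
  by apply: eq_bigr => g _; rewrite lactM.
have vA b : A b -> v b = 0.
  have [x <-] := orbit_proj_surj b => Apx; rewrite vE big1 ?mulr0// => g _.
  by rewrite uA//= orbit_proj_lact.
have vC b : C b -> v b = 1.
  have [x <-] := orbit_proj_surj b => Cpx; rewrite vE.
  rewrite (eq_bigr (fun=> 1)); last by move=> g _; rewrite uC//= orbit_proj_lact.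
  by rewrite sumr_const mulVf// gt_eqF.
exists (fun b => cutoff (3 * v b - 1)); split.
- exact: continuous_cutoff.
- by move=> b; exact: cutoff_bounds.
- move=> b /vA vb; have : \forall b' \near b, v b' < 1/3.
    apply: open_nbhs_nbhs; split; last by rewrite /= vb; lra.
    by apply: open_ltfun => //; exact: cst_continuous.
  by apply: filterS => b' ?; apply: cutoff0; lra.
- move=> b /vC vb; have : \forall b' \near b, 2/3 < v b'.
    apply: open_nbhs_nbhs; split; last by rewrite /= vb; lra.
    by apply: open_ltfun => //; exact: cst_continuous.
  by apply: filterS => b' ?; apply: cutoff1; lra.
Qed.

End OrbitUrysohn.

Lemma continuous_row (R : realType) (X : topologicalType) (q : nat)
    (f : 'I_q -> X -> R) :
  (forall j, continuous (f j)) -> continuous (fun x => \row_j f j x : 'rV[R]_q).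
Proof.
move=> cf x U [P nP PU].
have : \forall y \near x, forall j, P ord0 j (f j y).
  apply: filter_forall => j; have := nP ord0 j; rewrite mxE; exact: cf.
by apply: filterS => y Py; apply: PU => i j; rewrite ord1 mxE; exact: Py.
Qed.

(** * Orbit-injective maps built from local sections *)

Section CyclicAction.
Context {R : realType} {n : nat} {X : topologicalType}.
Context (a : free_left_action 'Z_n X).
Hypotheses (X_hausdorff : hausdorff_space X) (X_compact : compact [set: X]).
Local Notation B := (orbit_space a).
Local Notation p := (orbit_proj a).
Local Notation N := (Zp_trunc n).+2.

Lemma near_orbit (P : set B) x : (\forall b \near p x, P b) -> \forall y \near x, P (p y).
Proof. by move=> nP; exact: (@orbit_proj_continuous _ _ a x P nP). Qed.

(* Two local trivialisations h1, h2 give an equivariant map to the join of two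
   copies of Z_n; the edge from g to h is sent to the arc of the circle running
   forward from the g-th to the h-th vertex of the regular N-gon. *)
Lemma planar_map (F U1 U2 : set B) : closed F -> open U1 -> open U2 ->
  F `<=` U1 `|` U2 -> has_local_section p U1 -> has_local_section p U2 ->
  exists z1 z2 : X -> R,
    (forall x, (\forall b \near p x, F b) ->
       {for x, continuous z1} /\ {for x, continuous z2}) /\
    (forall x g g', F (p x) -> z1 (a g x) = z1 (a g' x) ->
       z2 (a g x) = z2 (a g' x) -> g = g').
Proof.
move=> cF oU1 oU2 FU sU1 sU2.
have [h1 [h1M h1c]] := local_section_label X_hausdorff oU1 sU1.
have [h2 [h2M h2c]] := local_section_label X_hausdorff oU2 sU2.
have [|||t [ct _ t0 t1]] := @orbit_urysohn R _ _ a X_hausdorff X_compact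
  (F `&` ~` U2) (F `&` ~` U1).
- by apply: closedI => //; exact: open_closedC.
- by apply: closedI => //; exact: open_closedC.
- by apply/seteqP; split=> // b [[Fb nU2] [_ nU1]]; have [] := FU b Fb.
(* The number of forward steps from the first label to the second. Over [U1] and [U2] it is constant
   on orbits, so the points of an orbit lie equally far past distinct vertices. *)
pose dl x : 'Z_n := ((h1 x)^-1 * h2 x)%g.
pose th x : R := angle N (val (h1 x)) (t (p x) * (val (dl x))%:R).
(* At [t = 1] the first label may be arbitrary, yet the arc ends at the vertex of the second one
   whatever its start. *)
have th1 x : t (p x) = 1 ->
    cos (th x) = cos (angle N (val (h2 x)) 0) :> R /\
    sin (th x) = sin (angle N (val (h2 x)) 0) :> R.
  move=> tx; rewrite /th tx mul1r.
  have -> : val (h2 x) = ((val (h1 x) + val (dl x)) %% N)%N.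
    have -> : h2 x = (h1 x * dl x)%g by rewrite mulgA mulgV mul1g.
    by [].
  by apply: angle_modn => //; exact: ltn_ord.
have U12 b : F b -> [\/ U1 b /\ U2 b, U1 b /\ t b = 0 | U2 b /\ t b = 1].
  move=> Fb; have [b1|nb1] := pselect (U1 b); last first.
    constructor 3; split; first by have [] := FU b Fb.
    exact: nbhs_singleton (t1 b (conj Fb nb1)).
  have [b2|nb2] := pselect (U2 b); first by constructor 1.
  by constructor 2; split=> //; exact: nbhs_singleton (t0 b (conj Fb nb2)).
exists (fun x => cos (th x)), (fun x => sin (th x)); split.
  move=> x nF; have Fx : F (p x) by exact: nbhs_singleton nF.
  (* Valid labels are locally constant, so near [x], up to full turns, [th] is a continuous offset
     [s] from a fixed vertex [k]. *)
  have near_th (k : nat) (s : X -> R) : {for x, continuous s} ->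
      (\forall y \near x, cos (th y) = cos (angle N k (s y)) :> R /\
                          sin (th y) = sin (angle N k (s y)) :> R) ->
      {for x, continuous (fun y => cos (th y))} /\
      {for x, continuous (fun y => sin (th y))}.
    move=> cs e; have [c1 c2] := continuous_angle N k cs.
    by split; [apply: eq_near_continuous c1|apply: eq_near_continuous c2];
      apply: filterS e => y [].
  have [b1|nb1] := pselect (U1 (p x)); last first.
    have b2 : U2 (p x) by have [] := FU _ Fx.
    apply: (near_th (val (h2 x)) (fun=> 0)); first exact: cst_continuous.
    have := h2c x b2; have := near_orbit (t1 _ (conj Fx nb1)).
    by apply: filterS2 => y ty <-; exact: th1.
  have [b2|nb2] := pselect (U2 (p x)); last first.
    apply: (near_th (val (h1 x)) (fun=> 0)); first exact: cst_continuous.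
    have := h1c x b1; have := near_orbit (t0 _ (conj Fx nb2)).
    by apply: filterS2 => y ty hy; rewrite /th ty hy mul0r.
  apply: (near_th (val (h1 x)) (fun y => t (p y) * (val (dl x))%:R)).
    apply: cvgM; last exact: cvg_cst.
    by apply: continuous_comp; [exact: orbit_proj_continuous|exact: ct].
  have := h2c x b2; have := h1c x b1.
  by apply: filterS2 => y e1 e2; rewrite /th /dl e1 e2.
have inj k l s : cos (angle N (val k) s) = cos (angle N (val l) s) :> R ->
    sin (angle N (val k) s) = sin (angle N (val l) s) :> R -> k = l :> 'Z_n.
  by move=> e1 e2; apply: val_inj; apply: (angle_inj _ _ _ e1 e2) => //; exact: ltn_ord.
move=> x g g' Fx; have [[b1 b2]|[b1 tx]|[b2 tx]] := U12 _ Fx.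
- have dlE k : dl (a k x) = dl x by rewrite /dl h1M// h2M// invMg -mulgA mulKg.
  rewrite /th !dlE !orbit_proj_lact => e1 e2.
  by have := inj _ _ _ e1 e2; rewrite !h1M// => /mulIg.
- rewrite /th !orbit_proj_lact tx !mul0r => e1 e2.
  by have := inj _ _ _ e1 e2; rewrite !h1M// => /mulIg.
- have [-> ->] : cos (th (a g x)) = cos (angle N (val (h2 (a g x))) 0) :> R /\
    sin (th (a g x)) = sin (angle N (val (h2 (a g x))) 0) :> R.
    by apply: th1; rewrite orbit_proj_lact.
  have [-> ->] : cos (th (a g' x)) = cos (angle N (val (h2 (a g' x))) 0) :> R /\
    sin (th (a g' x)) = sin (angle N (val (h2 (a g' x))) 0) :> R.
    by apply: th1; rewrite orbit_proj_lact.
  move=> e1 e2.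
  by have := inj _ _ _ e1 e2; rewrite !h2M// => /mulIg.
Qed.

(* The join with a third copy of Z_n: the circle of [planar_map] is shrunk to a
   point while the orbit is lifted to pairwise distinct heights. *)
Lemma spatial_map (U : 'I_3 -> set B) : (forall k, open (U k)) ->
  (forall k, has_local_section p (U k)) -> (forall b, exists k, U k b) ->
  exists f : X -> 'rV[R]_3, continuous f /\
    forall x g g', f (a g x) = f (a g' x) -> g = g'.
Proof.
move=> oU sU cov.
pose U0 := U ord0; pose U1 := U (lift ord0 ord0); pose U2 := U ord_max.
have [h [hM hc]] := local_section_label X_hausdorff (oU ord_max) (sU ord_max).
have covE b : [\/ U0 b, U1 b | U2 b].
  have [[[|[|[|//]]] i3] Ub] := cov b.
  - by constructor 1; rewrite /U0 (_ : ord0 = Ordinal i3)//; exact: val_inj.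
  - by constructor 2; rewrite /U1 (_ : lift _ _ = Ordinal i3)//; exact: val_inj.
  - by constructor 3; rewrite /U2 (_ : ord_max = Ordinal i3)//; exact: val_inj.
have oU01 : open (U0 `|` U1) by apply: openU; exact: oU.
have [|||s [cs s01 s0 s1]] := @orbit_urysohn R _ _ a X_hausdorff X_compact
  (~` U2) (~` (U0 `|` U1)).
- by apply: open_closedC; exact: oU.
- exact: open_closedC.
- apply/seteqP; split=> // b [/= n2 n01].
  by have [b0|b1|//] := covE b; apply: n01; [left|right].
pose F := [set b | s b <= 3/4].
have FU : F `<=` U0 `|` U1.
  move=> b Fb; apply: contrapT => /s1/nbhs_singleton sb.
  by move: Fb; rewrite /F /= sb; lra.
have cF : closed F by apply: closed_lefun => //; exact: cst_continuous.
have [z1 [z2 [cz zinj]]] := planar_map cF (oU _) (oU _) FU (sU _) (sU _).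
(* [w] reaches 1 at [s = 1/2], before the bound 3/4 of [F]: the factor [1 - w] already vanishes
   where the planar map may cease to be continuous. Near points off [U2], [w] is 0, which kills the
   arbitrary values of [h]. *)
pose w b := cutoff (2 * s b - 0).
have cw : continuous w by exact: continuous_cutoff.
have cwp : continuous (w \o p).
  by move=> x; apply: continuous_comp; [exact: orbit_proj_continuous|exact: cw].
have shrink (z : X -> R) :
    (forall x, (\forall b \near p x, F b) -> {for x, continuous z}) ->
    continuous (fun x => (1 - w (p x)) * z x).
  move=> cz' x; have [sx|sx] := ltP (s (p x)) (3/4).
    apply: cvgM; first by apply: cvgB; [exact: cvg_cst|exact: cwp].
    apply: cz'; have : \forall b \near p x, s b < 3/4.
      apply: open_nbhs_nbhs; split=> //.
      by apply: open_ltfun => //; exact: cst_continuous.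
    by apply: filterS => b /ltW.
  apply: (@eq_near_continuous _ _ _ (fun=> 0)); last exact: cst_continuous.
  have : \forall b \near p x, 1/2 < s b.
    apply: open_nbhs_nbhs; split; last by rewrite /=; lra.
    by apply: open_ltfun => //; exact: cst_continuous.
  move=> /near_orbit; apply: filterS => y sy.
  by rewrite /w cutoff1 ?subrr ?mul0r//; lra.
have lifted : continuous (fun x => w (p x) * (val (h x))%:R : R).
  move=> x; have [b2|nb2] := pselect (U2 (p x)).
    apply: (@eq_near_continuous _ _ _ (fun y => w (p y) * (val (h x))%:R)).
      by apply: filterS (hc x b2) => y ->.
    by apply: cvgM; [exact: cwp|exact: cvg_cst].
  apply: (@eq_near_continuous _ _ _ (fun=> 0)); last exact: cst_continuous.
  have := near_orbit (s0 _ nb2); apply: filterS => y sy.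
  by rewrite /w cutoff0 ?mul0r// sy; lra.
pose f (j : 'I_3) : X -> R := match val j with
  | 0%N => fun x => (1 - w (p x)) * z1 x
  | 1%N => fun x => (1 - w (p x)) * z2 x
  | _ => fun x => w (p x) * (val (h x))%:R end.
exists (fun x => \row_j f j x); split.
  apply: continuous_row => -[[|[|[|//]]] i3]; rewrite /f /=.
  - by apply: shrink => x /cz[].
  - by apply: shrink => x /cz[].
  - exact: lifted.
move=> x g g' /rowP fgg.
have := fgg ord0; have := fgg (lift ord0 ord0); have := fgg ord_max.
rewrite !mxE /f /= !orbit_proj_lact.
(* If [w = 0], the point lies over [F] and the first two coordinates are those of the planar map;
   otherwise it lies over [U2] and the heights tell the labels apart. *)
have [w0|/eqP w0] := eqVneq (w (p x)) 0.
  rewrite w0 subr0 !mul1r => _ e2 e1; apply: zinj e1 e2.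
  rewrite /F /= leNgt; apply/negP => sx.
  by move: w0; rewrite /w cutoff1; [move/eqP; rewrite oner_eq0|lra].
move=> /(mulfI (introN eqP w0))/eqP; rewrite eqr_nat => /eqP/val_inj + _ _.
have b2 : U2 (p x).
  apply: contrapT => /s0/nbhs_singleton sx; apply: w0.
  by rewrite /w cutoff0// sx; lra.
by rewrite !hM// => /mulIg.
Qed.

Lemma borsuk_ulam_no_two_sections (U1 U2 : set B) : borsuk_ulam_property a 'rV[R]_2 ->
  open U1 -> open U2 -> has_local_section p U1 -> has_local_section p U2 ->
  ~ (forall b, U1 b \/ U2 b).
Proof.
move=> BU oU1 oU2 sU1 sU2 cov.
have [|z1 [z2 [cz zinj]]] := @planar_map setT U1 U2 closedT oU1 oU2 _ sU1 sU2.
  by move=> b _; exact: cov.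
pose f (j : 'I_2) : X -> R := if val j == 0%N then z1 else z2.
have [|x [g [g' [gg' /rowP fgg]]]] := BU (fun x => \row_j f j x).
  apply: continuous_row => j x; have [c1 c2] := cz x filterT.
  by rewrite /f; case: ifP.
apply: gg'; apply: (zinj x) => //.
  by have := fgg ord0; rewrite !mxE.
by have := fgg ord_max; rewrite !mxE.
Qed.

End CyclicAction.

(** * Computation of the two invariants *)

Lemma least_natP (P : nat -> Prop) k :
  P k -> (forall j, (j < k)%N -> ~ P j) -> least_nat P = Some k.
Proof.
move=> Pk Pmin; rewrite /least_nat; case: pselect => [ex|]; last first.
  by case; exists k; apply/asboolP.
case: ex_minnP => m /asboolP Pm mmin; congr Some; apply/eqP; rewrite eqn_leq.
rewrite mmin ?andTb; last exact/asboolP.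
by rewrite leqNgt; apply/negP => /Pmin.
Qed.

(** [f] gives the tuple with entries [f (g_j^-1 x)], distinct because [f] is injective on orbits;
    conversely, by equivariance, the entry at the identity takes the values of the whole tuple along
    the orbit. *)
Lemma ind2_witness (R : realType) (gT : finGroupType) (e : enumeration gT)
    (X : topologicalType) (a : free_left_action gT X) (k : nat) :
  (exists f : X -> 'rV[R]_k.+1, continuous f /\
    forall x g g', f (a g x) = f (a g' x) -> g = g') <->
  exists f : X -> config 'rV[R]_k.+1 #|gT|,
    continuous f /\ forall g x, f (a g x) = config_act e g (f x).
Proof.
split=> [[f [cf finj]]|[f [cf fE]]].
  pose F x : {ptws 'I_#|gT| -> 'rV[R]_k.+1} := fun j => f (a (enum_elt e j)^-1%g x).
  have FP x : config_set (F x).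
    move=> i j ij /finj /invg_inj /(can_inj (enum_eltK e)).
    exact: ij.
  exists (fun x => exist _ (F x) (mem_set (FP x))); split.
    apply/continuous_comp_initial => x.
    apply/cvg_sup => j; move: x.
    apply/(@continuousP _ (initial_topology (@^~ j))) => A [D oD <-].
    apply: (@open_comp _ _ (fun x => f (a (enum_elt e j)^-1%g x)) D) => // x _.
    by apply: continuous_comp; [exact: lact_continuous|exact: cf].
  move=> g x; apply: val_inj; apply/funext => j.
  change (F (a g x) j = F x (enum_idx e (g^-1 * enum_elt e j)%g)).
  by rewrite /F enum_idxK invMg invgK lactM.
pose i0 := enum_idx e 1%g.
have ev g x : set_val (f (a g x)) i0 = set_val (f x) (enum_idx e g^-1%g).
  rewrite fE; change (set_val (f x) (enum_idx e (g^-1 * enum_elt e i0)%g) =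
    set_val (f x) (enum_idx e g^-1%g)).
  by rewrite enum_idxK mulg1.
exists (fun x => set_val (f x) i0); split.
  have cv : continuous (fun x => set_val (f x) : {ptws 'I_#|gT| -> 'rV[R]_k.+1}).
    by move=> x; apply: continuous_comp; [exact: cf|exact: initial_continuous].
  move=> x; apply: (@continuous_comp _ _ _ _
    (fun v : {ptws 'I_#|gT| -> 'rV[R]_k.+1} => v i0) x (cv x)).
  exact: (@proj_continuous _ (fun=> 'rV[R]_k.+1) i0).
move=> x g g'; rewrite !ev => fgg.
apply/invg_inj/(can_inj (enum_idxK e)); apply: contrapT => ne.
exact: (set_valP (f x) _ _ ne fgg).
Qed.

Lemma borsuk_ulam_no_injection (R : realType) (gT : finGroupType)
    (X : topologicalType) (a : free_left_action gT X) (k : nat) :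
  (k < 2)%N -> borsuk_ulam_property a 'rV[R]_2 ->
  ~ exists f : X -> 'rV[R]_k.+1, continuous f /\
      forall x g g', f (a g x) = f (a g' x) -> g = g'.
Proof.
move=> k2 BU [f [cf finj]].
(* For [k = 0] the only coordinate is repeated; for [k = 1] nothing changes. *)
pose pad (x : X) (j : 'I_2) : R := f x ord0 (inord (minn j k)).
have [|x [g [g' [gg' /rowP fgg]]]] := BU (fun x => \row_j pad x j).
  apply: (continuous_row (f := fun j x => pad x j)) => j x.
  apply: (continuous_comp (f := f)
    (g := fun v : 'rV[R]_k.+1 => v ord0 (inord (minn j k)))).
    exact: cf.
  exact: coord_continuous.
apply: gg'; apply: (finj x); apply/rowP => i.
have i2 : (i < 2)%N by exact: leq_trans (ltn_ord i) k2.
have := fgg (Ordinal i2); rewrite !mxE /pad /=.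
have -> : minn i k = i by apply/minn_idPl; rewrite -ltnS.
by rewrite inord_val.
Qed.

Lemma cover_of_card_le2 (T : Type) (C : set (set T)) k : (k <= 2)%N ->
  (C #= `I_k)%card -> [set: T] !=set0 -> \bigcup_(U in C) U = setT ->
  exists U1 U2, [/\ C U1, C U2 & forall x, U1 x \/ U2 x].
Proof.
move=> k2; rewrite card_eq_sym => /card_set_bijP[f [fC _ Csub]] [x0 _] cov.
have mem x : exists2 i, (i < k)%N & f i x.
  have : [set: T] x by [].
  by rewrite -cov => -[U /Csub[i /= ik <-] fx]; exists i.
have k0 : (0 < k)%N by have [i ik _] := mem x0; exact: leq_ltn_trans ik.
(* The two sets coincide when [k = 1]. *)
exists (f 0%N), (f k.-1); split; [exact: fC|by apply: fC; rewrite /= prednK|].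
move=> x; have [i ik fx] := mem x.
have [i0|i0] : i = 0%N \/ i = k.-1 by lia.
  by left; rewrite -i0.
by right; rewrite -i0.
Qed.

Theorem corollary4p9 (R : realType) (n : nat) (hn : (2 <= n)%N)
    (M : topologicalType)
    (M_surface : surface_without_boundary R M)
    (M_compact : compact [set: M]) (M_connected : connected [set: M])
    (a : free_left_action 'Z_n M) (e : enumeration 'Z_n)
    (M_borsuk_ulam : borsuk_ulam_property a 'rV[R]_2) :
  ind2 R e a = Some 2%N /\ secat (orbit_proj a) = Some 3%N.
Proof.
have M_hausdorff : hausdorff_space M by have [] := M_surface.
have [U [sU cov]] := local_section_cover a M_hausdorff M_compact
  (surface_locally_injects M_surface).
split; apply: least_natP.
- apply/ind2_witness; apply: (spatial_map M_hausdorff M_compact _ _ cov).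
    by move=> k; case: (sU k).
  by move=> k; case: (sU k).
- move=> k k2 /ind2_witness; exact: borsuk_ulam_no_injection M_borsuk_ulam.
- have no2 i j : (forall b, U i b \/ U j b) -> False.
    have [oi si] := sU i; have [oj sj] := sU j.
    exact: borsuk_ulam_no_two_sections M_borsuk_ulam oi oj si sj.
  (* [secat] counts a set of open sets, so the three must be distinct; if two coincided, two sets
     would already cover, against [no2]. *)
  have Uinj : injective U.
    move=> i j Uij; apply: contrapT => ij.
    have ijv : nat_of_ord i <> j by move/val_inj.
    (* The third index, since 0 + 1 + 2 = 3. *)
    pose l : 'I_3 := inord (3 - i - j).
    have ijl m : [\/ m = i, m = j | m = l].
      have [->|/eqP mi] := eqVneq m i; first by constructor 1.
      have [->|/eqP mj] := eqVneq m j; first by constructor 2.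
      have miv : nat_of_ord m <> i by move/val_inj.
      have mjv : nat_of_ord m <> j by move/val_inj.
      constructor 3; apply: val_inj; rewrite /= inordK; last by lia.
      by move: (ltn_ord i) (ltn_ord j) (ltn_ord m); lia.
    apply: (no2 i l) => b; have [m Um] := cov b.
    by have [mE|mE|mE] := ijl m; move: Um; rewrite mE ?Uij; [left|left|right].
  exists (range U); split.
  + rewrite card_eq_sym; apply/card_set_bijP; exists (fun i => U (inord i)); split.
    * by move=> i _; exists (inord i).
    * move=> i j; rewrite !inE /= => i3 j3 /Uinj /(congr1 val) /=.
      by rewrite !inordK.
    * by move=> _ [i _ <-]; exists (val i); rewrite /= ?inord_val ?ltn_ord.
  + by apply/seteqP; split=> // b _; have [i Ui] := cov b; exists (U i) => //; exists i.
  + by move=> _ [i _ <-]; exact: sU.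
- move=> k k3 [C [Ck covC CU]].
  have [||U1 [U2 [C1 C2 U12]]] := @cover_of_card_le2 _ C k _ Ck _ covC.
  + exact: k3.
  (* The Borsuk-Ulam property of a constant map provides a point of [M], which rules out the empty
     cover. *)
  + have [x _] := M_borsuk_ulam (fun=> 0) (@cst_continuous _ _ _).
    by exists (orbit_proj a x).
  + have [o1 s1] := CU _ C1; have [o2 s2] := CU _ C2.
    exact: (borsuk_ulam_no_two_sections M_hausdorff M_compact M_borsuk_ulam o1 o2 s1 s2).
Qed.
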